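(* Let $(I=I_\circ\sqcup I_\bullet,\tau)$ be a super Satake diagram of type A with admissible parameters, and let $i\in I_{\bar1}$. If $\tau i=i$, let $j(i)\in I_\bullet$ be the (unique) even simple root with $a_{i,j(i)}\ne0$. Then the element $\mathrm{Rem}^{p_0}_i:=p_0(B_i)=B_i^2$ of $\mathbf U^\imath$ is given by $$\mathrm{Rem}^{p_0}_i=-\delta_{i,\tau i}\,a_{i,j(i)}\,q_i^{a_{i,j(i)}}\,\varsigma_i\,E_{j(i)}$$ (the right-hand side being $0$ when $\tau i\neq i$).
   Context: **Root data.** The base field is $\mathbb C(q)$, $q$ an indeterminate. Let $V=V_{\bar0}\oplus V_{\bar1}$ be a complex superspace with $\dim V_{\bar0}=m$, $\dim V_{\bar1}=n$, with a homogeneous basis $v_1,\dots,v_{m+n}$ (any order of parities), $\mathfrak g=\mathfrak{gl}(V)$. Parities are denoted $|\cdot|\in\mathbb Z_2$. $P=\bigoplus_a\mathbb Z\epsilon_a$ has the form $(\epsilon_a,\epsilon_b)=(-1)^{|v_a|}\delta_{ab}$; $P^\vee=\bigoplus_a\mathbb Z\epsilon_a^\vee$, $\langle\epsilon_a^\vee,\epsilon_b\rangle=\delta_{ab}$; $|\epsilon_a|=|v_a|$. $I=\{1,\dots,m+n-1\}$, $\alpha_i=\epsilon_i-\epsilon_{i+1}$, $|i|=|\alpha_i|=|\epsilon_i|+|\epsilon_{i+1}|$, $h_i=\epsilon_i^\vee-(-1)^{|i|}\epsilon_{i+1}^\vee$, $a_{ij}=\langle h_i,\alpha_j\rangle$,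 $d_i=(-1)^{|\epsilon_i|}$, so $(\alpha_i,\alpha_j)=d_ia_{ij}$; $q_i=q^{d_i}$. $Y=\bigoplus\mathbb Zh_i$. $I_{\bar0},I_{\bar1}$ are the sets of even, odd $i\in I$. For homogeneous $x,y$: $[x,y]_a=xy-(-1)^{|x||y|}a\,yx$, $[x,y]=[x,y]_1$. **Quantum enveloping superalgebra.** $\mathbf U$ is the unital associative $\mathbb C(q)$-superalgebra generated by $E_i,F_i$ ($i\in I$, of parity $|i|$) and even $K_h$ ($h\in P^\vee$) with relations: $K_0=1$, $K_hK_{h'}=K_{h+h'}$; $K_hE_i=q^{\langle h,\alpha_i\rangle}E_iK_h$, $K_hF_i=q^{-\langle h,\alpha_i\rangle}F_iK_h$; $[E_i,F_j]=\delta_{ij}\frac{K_i-K_i^{-1}}{q_i-q_i^{-1}}$ with $K_i:=K_{h_i}^{d_i}$; $[E_i,E_j]=0=[F_i,F_j]$ if $a_{ij}=0$; $[E_i,[E_i,E_j]_{q_i^{-1}}]_{q_i}=0=[F_i,[F_i,F_j]_{q_i^{-1}}]_{q_i}$ if $|a_{ij}|=1$, $|i|=\bar0$; and $[[[E_{j-1},E_j]_{q_j},E_{j+1}]_{q_{j+1}},E_j]=0=[[[F_{j-1},F_j]_{q_j},F_{j+1}]_{q_{j+1}},F_j]$ if $1<j<m+n-1$, $|j|=\bar1$. For $i\in I_{\bar0}$, $T_i$ is the superalgebra automorphism of $\mathbf U$ with $T_i(E_i)=-F_iK_i$, $T_i(F_i)=-K_i^{-1}E_i$; $T_i(E_j)=E_j$,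 $T_i(F_j)=F_j$ if $|j-i|>1$; $T_i(E_j)=E_iE_j-q^{(\alpha_i,\alpha_j)}E_jE_i$, $T_i(F_j)=F_jF_i-q^{-(\alpha_i,\alpha_j)}F_iF_j$ if $|j-i|=1$; $T_i(K_h)=K_{s_i(h)}$, $s_i(h)=h-\langle h,\alpha_i\rangle h_i$. The $T_i$ satisfy the braid relations. **Super Satake diagrams of type A.** A pair $(I=I_\circ\sqcup I_\bullet,\tau)$ with $I_\bullet\subseteq I_{\bar0}$ (''black'' nodes; $I_\circ$ are ''white'') and $\tau$ a parity-preserving diagram symmetry ($\tau=\mathrm{id}$ or $\tau(i)=m+n-i$) such that, with $W_\bullet=\langle s_j: j\in I_\bullet\rangle$, $w_\bullet$ its longest element, $\rho_\bullet^\vee$ half the sum of positive coroots of the subsystem of $I_\bullet$: (1) $\tau^2=\mathrm{id}$; (2) $\tau(I_\bullet)=I_\bullet$ and $-w_\bullet(\alpha_i)=\alpha_{\tau i}$ for $i\in I_\bullet$; (3) if $j\in I_{\bar0}\cap I_\circ$ and $\tau j=j$ then $\langle\rho_\bullet^\vee,\alpha_j\rangle\in\mathbb Z$; (4) if $j\in I_{\bar1}\cap I_\circ$ and $\tau j=j$ then $\langle\rho_\bullet^\vee,\alpha_j\rangle\ne0$; and, when $\tau=\mathrm{id}$, every odd node is adjacent to exactly one black node. (Explicitly: for $\tau=\mathrm{id}$ black nodes are pairwise non-adjacent, each white even node has $0$ or $2$ black neighbours, each odd node exactly one; for $\tau\neq\mathrm{id}$, $I_\bullet$ is empty or a $\tau$-stable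 central interval, and a white $\tau$-fixed node is even.) **$\imath$Quantum enveloping superalgebra.** $\tau$ acts on $Y$ by $\tau(h_i)=h_i$ if $\tau i=i$ and $\tau(h_i)=(-1)^{|i|}h_{\tau i}$ if $\tau i\ne i$. $Y^\imath=\{h\in Y\mid -w_\bullet\tau(h)=h\}$; $\mathbf U^{\imath0}$ is the subalgebra generated by $K_h$, $h\in Y^\imath$. $T_{w_\bullet}=T_{i_1}\cdots T_{i_k}$ for a reduced expression $w_\bullet=s_{i_1}\cdots s_{i_k}$. For parameters $\varsigma_i\in\mathbb C(q)^*$, $\kappa_i\in\mathbb C(q)$ ($i\in I_\circ$), $\mathbf U^\imath$ is the subalgebra of $\mathbf U$ generated by $\mathbf U^{\imath0}$, $E_i,F_i$ ($i\in I_\bullet$) and $B_i=F_i+\varsigma_iT_{w_\bullet}(E_{\tau i})K_i^{-1}+\kappa_iK_i^{-1}$ ($i\in I_\circ$). Let $I_{\mathrm{ns}}=\{i\in I_\circ\mid\tau i=i,\ \langle h_j,\alpha_i\rangle=0\ \forall j\in I_\bullet\}$. Admissible parameters: (a) $\kappa_i=0$ unless $i\in I_{\mathrm{ns}}$ and $\langle h_k,\alpha_i\rangle\in2\mathbb Z$ for all $k\in I_{\mathrm{ns}}\setminus\{i\}$; (b) $\varsigma_i=\varsigma_{\tau i}$ if $(\alpha_i,\alpha_{\tau i})=0$ and $w_\bullet(\alpha_i)=\alpha_i$; (c) $\varsigma_i=\varsigma_{\tau i}$ if $|i|=\bar1$ and $(\alpha_i,\alpha_{\tau i})\in2\mathbb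 Z\setminus\{0\}$. The quantum Serre polynomial here is $p_0(x_i)=x_i^2$ for $i\in I_{\bar1}$. *)

(* Defs.v *)
From HB Require Import structures.
From mathcomp Require Import all_boot all_order all_algebra.
From mathcomp Require Import generic_quotient ring_quotient.
From mathcomp Require Import boolp reals complex monalg.

Set Implicit Arguments.
Unset Strict Implicit.
Unset Printing Implicit Defensive.

Import Order.TTheory GRing.Theory Num.Theory.

Local Open Scope ring_scope.
Local Open Scope quotient_scope.

(* The field C(q), where C = R[i] for a model R of the real numbers. *)
Notation Cq R := {fraction {poly (complex R)}}.

Definition qvar (R : realType) : Cq R := tofrac 'X.

(******************************************************************************)
(* Root data of gl(V)                                                         *)
(*                                                                            *)
(* N = m + n, and p a says that the basis vector v_(a+1) is odd. The index    *)
(* sets are shifted to start at 0, so the node i of the diagram stands for    *)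
(* alpha_i = eps_i - eps_(i+1) with both indices in 'I_N. The lattices P and  *)
(* P^vee are both 'rV[int]_N, in the bases eps_a and eps_a^vee respectively.  *)
(******************************************************************************)
Section RootData.
Variables (N : nat) (p : 'I_N -> bool).
Implicit Types (i j : 'I_N.-1) (h x y : 'rV[int]_N).

Lemma node_succ_subproof i : (i.+1 < N)%N.
Proof. by rewrite -ltn_predRL ltn_ord. Qed.

Definition node_l i : 'I_N := widen_ord (leq_pred N) i.
Definition node_r i : 'I_N := Ordinal (node_succ_subproof i).

Definition eps (a : 'I_N) : 'rV[int]_N := delta_mx 0 a.
Definition epsv (a : 'I_N) : 'rV[int]_N := delta_mx 0 a.

Definition pairing h x : int := \sum_a h 0 a * x 0 a.
Definition form x y : int := \sum_a (-1) ^+ p a * x 0 a * y 0 a.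

Definition alpha i := eps (node_l i) - eps (node_r i).
Definition npar i : bool := p (node_l i) (+) p (node_r i).
Definition coroot i := epsv (node_l i) - (-1) ^+ npar i *: epsv (node_r i).
Definition cartan i j : int := pairing (coroot i) (alpha j).
Definition dsym i : int := (-1) ^+ p (node_l i).
Definition adjacent i j : bool := (i.+1 == j :> nat) || (j.+1 == i :> nat).

(* The Weyl group is only used for sets of even nodes. A word [:: i1; ..; ik] *)
(* denotes s_i1 ... s_ik.                                                     *)
Definition refl i x := x - pairing (coroot i) x *: alpha i.
Definition reflv i h := h - pairing h (alpha i) *: coroot i.
Definition refl_word (w : seq 'I_N.-1) x := foldr refl x w.
Definition reflv_word (w : seq 'I_N.-1) h := foldr reflv h w.

Definition reduced (J : {set 'I_N.-1}) (w : seq 'I_N.-1) : Prop :=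
  {subset w <= J} /\
  forall w' : seq 'I_N.-1, {subset w' <= J} ->
    refl_word w' =1 refl_word w -> (size w <= size w')%N.

(* w is a reduced expression of the longest element of <s_j : j in J> *)
Definition longest_expr (J : {set 'I_N.-1}) (w : seq 'I_N.-1) : Prop :=
  reduced J w /\ forall w', reduced J w' -> (size w' <= size w)%N.

Definition sub_coroot (J : {set 'I_N.-1}) h : Prop :=
  exists w j, [/\ {subset w <= J}, j \in J & h = reflv_word w (coroot j)].

(* Twice rho^vee: J consists of even nodes, so its coroots all have the form  *)
(* epsv a - epsv b, and the positive ones are those with a < b.               *)
Definition two_rhov (J : {set 'I_N.-1}) : 'rV[int]_N :=
  \sum_(ab : 'I_N * 'I_N
       | (ab.1 < ab.2)%N && `[< sub_coroot J (epsv ab.1 - epsv ab.2) >])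
     (epsv ab.1 - epsv ab.2).

Definition rhov_pairing (J : {set 'I_N.-1}) x : rat :=
  (pairing (two_rhov J) x)%:~R / 2%:R.

(* wb is a reduced expression of w_bullet *)
Record super_satake (Ib : {set 'I_N.-1}) (tau : 'I_N.-1 -> 'I_N.-1)
    (wb : seq 'I_N.-1) : Prop := SuperSatake {
  satake_even : forall i, i \in Ib -> ~~ npar i;
  satake_sym : tau =1 id \/ tau =1 @rev_ord N.-1;
  satake_par : forall i, npar (tau i) = npar i;
  satake_invol : forall i, tau (tau i) = i;
  satake_stable : [set tau i | i in Ib] = Ib;
  satake_w : forall i, i \in Ib -> - refl_word wb (alpha i) = alpha (tau i);
  satake_white_even : forall j, j \notin Ib -> ~~ npar j -> tau j = j ->
    rhov_pairing Ib (alpha j) \is a Num.int;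
  satake_white_odd : forall j, j \notin Ib -> npar j -> tau j = j ->
    rhov_pairing Ib (alpha j) != 0;
  satake_id_odd : tau =1 id -> forall i, npar i ->
    #|[set j in Ib | adjacent i j]| = 1%N
}.

Definition ns_node (Ib : {set 'I_N.-1}) (tau : 'I_N.-1 -> 'I_N.-1) i :
    bool :=
  [&& i \notin Ib, tau i == i
    & [forall j, (j \in Ib) ==> (pairing (coroot j) (alpha i) == 0)]].

Definition tau_coroot (tau : 'I_N.-1 -> 'I_N.-1) i : 'rV[int]_N :=
  if tau i == i then coroot i else (-1) ^+ npar i *: coroot (tau i).

(* Y^imath; the h_i form a basis of Y, so c is determined by h. *)
Definition Yi (tau : 'I_N.-1 -> 'I_N.-1) (wb : seq 'I_N.-1) h : Prop :=
  exists c : 'I_N.-1 -> int,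
    h = \sum_i c i *: coroot i
    /\ - reflv_word wb (\sum_i c i *: tau_coroot tau i) = h.

End RootData.

(* A homogeneous element together with its parity, on which the sign in the
   bracket [x, y]_a depends *)
Record homog (A : Type) := Homog { hpar : bool; hval : A }.

Definition sbracket (k : comNzRingType) (A : lalgType k) (a : k)
    (x y : homog A) : homog A :=
  Homog (hpar x (+) hpar y)
    (hval x * hval y
     - ((-1) ^+ (hpar x && hpar y) * a) *: (hval y * hval x)).

Lemma sbracket_eq0 (k : comNzRingType) (A : lalgType k) (f : A -> k) :
  {morph f : x y / x - y} -> {morph f : x y / x * y} ->
  (forall a x, f (a *: x) = a * f x) ->
  forall a x y, f (hval x) = 0 -> f (hval y) = 0 ->
    f (hval (sbracket a x y)) = 0.
Proof.
by move=> fB fM fZ a x y x0 y0; rewrite fB fZ !fM x0 y0 !mulr0 subr0.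
Qed.

Section AlgebraQuotient.
Variables (k : comNzRingType) (A : algType k).

(* The two-sided ideal generated by the differences lhs - rhs *)
Inductive rel_ideal (r : A -> A -> Prop) : A -> Prop :=
| rel_ideal_rel x y of r x y : rel_ideal r (x - y)
| rel_ideal_0 : rel_ideal r 0
| rel_ideal_D x y of rel_ideal r x & rel_ideal r y : rel_ideal r (x + y)
| rel_ideal_Ml a x of rel_ideal r x : rel_ideal r (a * x)
| rel_ideal_Mr x a of rel_ideal r x : rel_ideal r (x * a).

(* Rings are nontrivial in MathComp, hence the second field. *)
Record relations := Relations {
  rel_of :> A -> A -> Prop;
  rel_proper : ~ rel_ideal rel_of 1
}.

Variable r : relations.

Definition rel_ideal_pred : {pred A} := fun x => `[< rel_ideal r x >].

Lemma rel_ideal_zmod_closed : zmod_closed rel_ideal_pred.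
Proof.
split=> [|x y /asboolP hx /asboolP hy]; apply/asboolP.
  exact: rel_ideal_0.
by rewrite -mulN1r; apply: rel_ideal_D => //; apply: rel_ideal_Ml.
Qed.

HB.instance Definition _ :=
  GRing.isZmodClosed.Build A rel_ideal_pred rel_ideal_zmod_closed.

Definition alg_quot : Type := Quotient.quot rel_ideal_pred.
HB.instance Definition _ := GRing.Zmodule.on alg_quot.
HB.instance Definition _ := EqQuotient.on alg_quot.

Definition toQ (x : A) : alg_quot := \pi_alg_quot x.

Lemma toQK (x : alg_quot) : toQ (repr x) = x. Proof. exact: reprK. Qed.

Lemma toQ_eq x y : (toQ x = toQ y) <-> rel_ideal r (x - y).
Proof.
split=> [/eqP|H]; first by rewrite -Quotient.idealrBE => /asboolP.
by apply/eqP; rewrite -Quotient.idealrBE; apply/asboolP.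
Qed.

Lemma toQD x y : toQ (x + y) = toQ x + toQ y.
Proof. exact: Quotient.pi_add. Qed.

Lemma toQ0 : toQ 0 = 0.
Proof. by apply: (addrI (toQ 0)); rewrite -toQD !addr0. Qed.

Definition alg_quot_one : alg_quot := toQ 1.
Definition alg_quot_mul (x y : alg_quot) : alg_quot := toQ (repr x * repr y).
Definition alg_quot_scale (a : k) (x : alg_quot) : alg_quot :=
  toQ (a *: repr x).
Local Notation Qmul := alg_quot_mul.
Local Notation Qscale := alg_quot_scale.

Lemma toQ_mul x y : toQ (x * y) = Qmul (toQ x) (toQ y).
Proof.
have hx : rel_ideal r (x - repr (toQ x)) by apply/toQ_eq; rewrite toQK.
have hy : rel_ideal r (y - repr (toQ y)) by apply/toQ_eq; rewrite toQK.
apply/toQ_eq; rewrite -[X in X - _](subrK (x * repr (toQ y))) -addrA.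
rewrite -mulrBr -mulrBl.
by apply: rel_ideal_D; [apply: rel_ideal_Ml|apply: rel_ideal_Mr].
Qed.

Lemma toQ_scale a x : toQ (a *: x) = Qscale a (toQ x).
Proof.
apply/toQ_eq; rewrite -scalerBr -[X in rel_ideal _ (_ *: X)]mul1r scalerAl.
by apply: rel_ideal_Ml; apply/toQ_eq; rewrite toQK.
Qed.

Lemma alg_quot_mulA : associative Qmul.
Proof.
by move=> x y z; rewrite -[x]toQK -[y]toQK -[z]toQK -!toQ_mul mulrA.
Qed.
Lemma alg_quot_mul1 : left_id alg_quot_one Qmul.
Proof. by move=> x; rewrite -[x]toQK -toQ_mul mul1r. Qed.
Lemma alg_quot_mulr1 : right_id alg_quot_one Qmul.
Proof. by move=> x; rewrite -[x]toQK -toQ_mul mulr1. Qed.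
Lemma alg_quot_mulDl : left_distributive Qmul +%R.
Proof.
move=> x y z; rewrite -[x]toQK -[y]toQK -[z]toQK.
by rewrite -toQD -!toQ_mul -toQD mulrDl.
Qed.
Lemma alg_quot_mulDr : right_distributive Qmul +%R.
Proof.
move=> x y z; rewrite -[x]toQK -[y]toQK -[z]toQK.
by rewrite -toQD -!toQ_mul -toQD mulrDr.
Qed.
Lemma alg_quot_one_neq0 : alg_quot_one != 0.
Proof.
apply/eqP => H; case: (rel_proper (r := r)).
by rewrite -[X in rel_ideal _ X]subr0; apply/toQ_eq; rewrite toQ0.
Qed.

HB.instance Definition _ := GRing.Zmodule_isNzRing.Build alg_quot
  alg_quot_mulA alg_quot_mul1 alg_quot_mulr1 alg_quot_mulDl alg_quot_mulDr
  alg_quot_one_neq0.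

Lemma alg_quot_scaleA a b x : Qscale a (Qscale b x) = Qscale (a * b) x.
Proof. by rewrite -[x]toQK -!toQ_scale scalerA. Qed.
Lemma alg_quot_scale1 : left_id 1 Qscale.
Proof. by move=> x; rewrite -[x]toQK -toQ_scale scale1r. Qed.
Lemma alg_quot_scaleDr : right_distributive Qscale +%R.
Proof.
move=> a x y; rewrite -[x]toQK -[y]toQK.
by rewrite -toQD -!toQ_scale -toQD scalerDr.
Qed.
Lemma alg_quot_scaleDl x : {morph Qscale^~ x : a b / a + b}.
Proof.
by move=> a b; rewrite -[x]toQK -!toQ_scale -toQD scalerDl.
Qed.

HB.instance Definition _ := GRing.Zmodule_isLmodule.Build k alg_quot
  alg_quot_scaleA alg_quot_scale1 alg_quot_scaleDr alg_quot_scaleDl.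

Lemma alg_quot_scaleAl a (x y : alg_quot) : a *: (x * y) = (a *: x) * y.
Proof.
rewrite -[x]toQK -[y]toQK; set u := repr x; set v := repr y.
change (Qscale a (Qmul (toQ u) (toQ v)) = Qmul (Qscale a (toQ u)) (toQ v)).
by rewrite -toQ_mul -!toQ_scale -toQ_mul scalerAl.
Qed.

HB.instance Definition _ :=
  GRing.Lmodule_isLalgebra.Build k alg_quot alg_quot_scaleAl.

Lemma alg_quot_scaleAr a (x y : alg_quot) : a *: (x * y) = x * (a *: y).
Proof.
rewrite -[x]toQK -[y]toQK; set u := repr x; set v := repr y.
change (Qscale a (Qmul (toQ u) (toQ v)) = Qmul (toQ u) (Qscale a (toQ v))).
by rewrite -toQ_mul -!toQ_scale -toQ_mul scalerAr.
Qed.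

HB.instance Definition _ :=
  GRing.Lalgebra_isAlgebra.Build k alg_quot alg_quot_scaleAr.

Lemma toQM x y : toQ (x * y) = toQ x * toQ y. Proof. exact: toQ_mul. Qed.
Lemma toQZ a x : toQ (a *: x) = a *: toQ x. Proof. exact: toQ_scale. Qed.
Lemma toQ1 : toQ 1 = 1. Proof. by []. Qed.

End AlgebraQuotient.

Section FreeAlgebra.
Variables (k : comNzRingType) (X : choiceType).

Definition free_alg := {malg k[{fmonom X}]}.
HB.instance Definition _ := GRing.Lalgebra.on free_alg.

Lemma free_alg_scaleAr a (x y : free_alg) : a *: (x * y) = x * (a *: y).
Proof.
have C z : z * a%:MP = a *: z :> {malg k[{fmonom X}]}.
  rewrite malgM_def fgmulgU -mul_malgC malgM_def fgmulUg.
  by apply: eq_bigr => m _; rewrite mulm1 mul1m mulrC.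
have E : a *: (x * y) = a *: x * y by apply: scalerAl.
rewrite E -[RHS](congr1 (fun z => x * z) (mul_malgC a y)) mulrA.
by rewrite (C x).
Qed.

HB.instance Definition _ :=
  GRing.Lalgebra_isAlgebra.Build k free_alg free_alg_scaleAr.

Definition free_gen (g : X) : free_alg := << fmu g >>.

End FreeAlgebra.

Section Uq.
Variables (k : fieldType) (q : k) (N : nat) (p : 'I_N -> bool).
Implicit Types (i j l : 'I_N.-1) (h : 'rV[int]_N).

Definition qnode i : k := q ^ dsym p i.

(* Generators: E_i, F_i and K_h, in this order. *)
Definition Ugen : choiceType := ('I_N.-1 + 'I_N.-1 + 'rV[int]_N)%type.

Local Notation FreeU := (free_alg k Ugen).

Definition fE i : homog FreeU :=
  Homog (npar p i) (free_gen k (inl (inl i) : Ugen)).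
Definition fF i : homog FreeU :=
  Homog (npar p i) (free_gen k (inl (inr i) : Ugen)).
Definition fK h : FreeU := free_gen k (inr h : Ugen).

Local Notation "[ x , y ]_ a" := (sbracket a x y)
  (at level 0, a at level 2, format "[ x ,  y ]_ a").

(* Urel x y is the defining relation x = y of U. *)
Inductive Urel : FreeU -> FreeU -> Prop :=
| Urel_K0 : Urel (fK 0) 1
| Urel_KD h h' : Urel (fK (h + h')) (fK h * fK h')
| Urel_KE h i : Urel (fK h * hval (fE i))
    (q ^ pairing h (alpha i) *: (hval (fE i) * fK h))
| Urel_KF h i : Urel (fK h * hval (fF i))
    (q ^ (- pairing h (alpha i)) *: (hval (fF i) * fK h))
| Urel_EF i j : Urel (hval [fE i, fF j]_1)
    ((i == j)%:R *: ((qnode i - (qnode i)^-1)^-1 *: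
      (fK (dsym p i *: coroot p i) - fK (- (dsym p i *: coroot p i)))))
| Urel_EE i j of cartan p i j = 0 : Urel (hval [fE i, fE j]_1) 0
| Urel_FF i j of cartan p i j = 0 : Urel (hval [fF i, fF j]_1) 0
| Urel_EEE i j of `|cartan p i j| = 1 & ~~ npar p i :
    Urel (hval [fE i, [fE i, fE j]_((qnode i)^-1)]_(qnode i)) 0
| Urel_FFF i j of `|cartan p i j| = 1 & ~~ npar p i :
    Urel (hval [fF i, [fF i, fF j]_((qnode i)^-1)]_(qnode i)) 0
| Urel_EEEE i j l of i.+1 = j :> nat & j.+1 = l :> nat & npar p j :
    Urel (hval [[[fE i, fE j]_(qnode j), fE l]_(qnode l), fE j]_1) 0
| Urel_FFFF i j l of i.+1 = j :> nat & j.+1 = l :> nat & npar p j :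
    Urel (hval [[[fF i, fF j]_(qnode j), fF l]_(qnode l), fF j]_1) 0.

(* U is nonzero: the counit kills E_i, F_i and sends K_h to 1. *)
Definition is_K (g : Ugen) : bool := if g is inr _ then true else false.
Definition Ucounit_mon (w : {fmonom Ugen}) : k := (all is_K w)%:R.

Lemma Ucounit_mon_morph : mmorphism Ucounit_mon.
Proof.
split=> [x y|]; last by rewrite /Ucounit_mon fm1.
by rewrite /Ucounit_mon fmM all_cat -natrM mulnb.
Qed.

HB.instance Definition _ :=
  isMultiplicative.Build {fmonom Ugen} k Ucounit_mon Ucounit_mon_morph.

Definition Ucounit (x : FreeU) : k := mmap idfun Ucounit_mon x.

Lemma UcounitZ a x : Ucounit (a *: x) = a * Ucounit x.
Proof. exact: mmapZ. Qed.
Lemma UcounitB x y : Ucounit (x - y) = Ucounit x - Ucounit y.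
Proof. exact: mmapB. Qed.
Lemma UcounitD x y : Ucounit (x + y) = Ucounit x + Ucounit y.
Proof. exact: mmapD. Qed.
Lemma UcounitM x y : Ucounit (x * y) = Ucounit x * Ucounit y.
Proof. exact: (rmorphM (mmap idfun Ucounit_mon)). Qed.
Lemma Ucounit0 : Ucounit 0 = 0.
Proof. exact: mmap0. Qed.
Lemma Ucounit1 : Ucounit 1 = 1.
Proof. exact: mmap1. Qed.

Lemma Ucounit_gen g : Ucounit (free_gen k (g : Ugen)) = (is_K g)%:R.
Proof.
by rewrite /Ucounit /free_gen mmapU mul1r /= /Ucounit_mon fmuE /= andbT.
Qed.

Lemma Ucounit_bracket a x y : Ucounit (hval x) = 0 -> Ucounit (hval y) = 0 ->
  Ucounit (hval [x, y]_a) = 0.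
Proof. exact: (sbracket_eq0 UcounitB UcounitM UcounitZ). Qed.

Lemma Ucounit_ideal x : rel_ideal Urel x -> Ucounit x = 0.
Proof.
have E0 i : Ucounit (hval (fE i)) = 0 by rewrite Ucounit_gen.
have F0 i : Ucounit (hval (fF i)) = 0 by rewrite Ucounit_gen.
have K1 h : Ucounit (fK h) = 1 by rewrite Ucounit_gen.
have B := Ucounit_bracket.
elim=> {x} [x y xy||x y _ hx _ hy|a x _ hx|x a _ hx]; first last.
- by rewrite UcounitM hx mul0r.
- by rewrite UcounitM hx mulr0.
- by rewrite UcounitD hx hy addr0.
- by rewrite Ucounit0.
rewrite UcounitB; apply/eqP; rewrite subr_eq0; apply/eqP.
have B0 a u v : Ucounit (hval u) = 0 -> Ucounit (hval v) = 0 ->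
  Ucounit (hval [u, v]_a) = Ucounit 0 by move=> *; rewrite Ucounit0 B.
case: xy => [|h h'|h i|h i|i j|i j _|i j _|i j _ _|i j _ _|i j l _ _ _
  |i j l _ _ _]; try by apply: B0 => //; apply: B.
- by rewrite K1 Ucounit1.
- by rewrite (UcounitM (fK h) (fK h')) !K1 mulr1.
- apply: (etrans (UcounitM (fK h) (hval (fE i)))); rewrite E0 mulr0.
  apply/esym/(etrans (UcounitZ _ (hval (fE i) * fK h))).
  by rewrite (UcounitM (hval (fE i)) (fK h)) E0 mul0r mulr0.
- apply: (etrans (UcounitM (fK h) (hval (fF i)))); rewrite F0 mulr0.
  apply/esym/(etrans (UcounitZ _ (hval (fF i) * fK h))).
  by rewrite (UcounitM (hval (fF i)) (fK h)) F0 mul0r mulr0.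
- by rewrite B // 2!UcounitZ UcounitB !K1 subrr !mulr0.
- exact: (B0 _ _ _ (B _ _ _ (B _ _ _ (E0 _) (E0 _)) (E0 _)) (E0 _)).
- exact: (B0 _ _ _ (B _ _ _ (B _ _ _ (F0 _) (F0 _)) (F0 _)) (F0 _)).
Qed.

Lemma Urel_proper : ~ rel_ideal Urel 1.
Proof. by move/Ucounit_ideal/eqP; rewrite Ucounit1 oner_eq0. Qed.

Definition Urelations : relations FreeU := Relations Urel_proper.

Definition Uq := alg_quot Urelations.
HB.instance Definition _ := GRing.Algebra.on Uq.

Definition Egen i : Uq := toQ Urelations (hval (fE i)).
Definition Fgen i : Uq := toQ Urelations (hval (fF i)).
Definition Kgen h : Uq := toQ Urelations (fK h).

(* K_i = K_(h_i)^(d_i), where K_h^d = K_(d h) *)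
Definition Knode i : Uq := Kgen (dsym p i *: coroot p i).
Definition Knode_inv i : Uq := Kgen (- (dsym p i *: coroot p i)).

(* homogeneous b x: x lies in the component of parity b of U *)
Inductive homogeneous : bool -> Uq -> Prop :=
| homogeneous_E i : homogeneous (npar p i) (Egen i)
| homogeneous_F i : homogeneous (npar p i) (Fgen i)
| homogeneous_K h : homogeneous false (Kgen h)
| homogeneous_0 b : homogeneous b 0
| homogeneous_D b x y of homogeneous b x & homogeneous b y :
    homogeneous b (x + y)
| homogeneous_Z b a x of homogeneous b x : homogeneous b (a *: x)
| homogeneous_1 : homogeneous false 1
| homogeneous_M b c x y of homogeneous b x & homogeneous c y :
    homogeneous (b (+) c) (x * y).

Record braid_operator i (T : {lrmorphism Uq -> Uq}) : Prop := BraidOperator {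
  braid_bij : bijective T;
  braid_par : forall b x, homogeneous b x -> homogeneous b (T x);
  braid_Ei : T (Egen i) = - (Fgen i * Knode i);
  braid_Fi : T (Fgen i) = - (Knode_inv i * Egen i);
  braid_E_far : forall j, j != i -> ~~ adjacent i j -> T (Egen j) = Egen j;
  braid_F_far : forall j, j != i -> ~~ adjacent i j -> T (Fgen j) = Fgen j;
  braid_E_adj : forall j, adjacent i j ->
    T (Egen j) = Egen i * Egen j
                 - q ^ form p (alpha i) (alpha j) *: (Egen j * Egen i);
  braid_F_adj : forall j, adjacent i j ->
    T (Fgen j) = Fgen j * Fgen i
                 - q ^ (- form p (alpha i) (alpha j)) *: (Fgen i * Fgen j);
  braid_K : forall h, T (Kgen h) = Kgen (reflv p i h)
}.

(* T_w = T_i1 ... T_ik for w = [:: i1; ..; ik] *)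
Definition braid_word (T : 'I_N.-1 -> {lrmorphism Uq -> Uq})
    (w : seq 'I_N.-1) (x : Uq) : Uq :=
  foldr (fun i y => T i y) x w.

Inductive subalg_gen (S : Uq -> Prop) : Uq -> Prop :=
| subalg_gen_in x of S x : subalg_gen S x
| subalg_gen_1 : subalg_gen S 1
| subalg_gen_D x y of subalg_gen S x & subalg_gen S y : subalg_gen S (x + y)
| subalg_gen_Z a x of subalg_gen S x : subalg_gen S (a *: x)
| subalg_gen_M x y of subalg_gen S x & subalg_gen S y : subalg_gen S (x * y).

Section IQuantum.
Variables (T : 'I_N.-1 -> {lrmorphism Uq -> Uq}).
Variables (Ib : {set 'I_N.-1}) (tau : 'I_N.-1 -> 'I_N.-1) (wb : seq 'I_N.-1).
Variables (vs kap : 'I_N.-1 -> k).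

Definition Bgen i : Uq :=
  Fgen i + vs i *: (braid_word T wb (Egen (tau i)) * Knode_inv i)
  + kap i *: Knode_inv i.

Definition Ui0 : Uq -> Prop :=
  subalg_gen (fun x => exists2 h, Yi p tau wb h & x = Kgen h).

Definition Ui : Uq -> Prop :=
  subalg_gen (fun x => [\/ Ui0 x,
    (exists2 i, i \in Ib & x = Egen i \/ x = Fgen i)
  | exists2 i, i \notin Ib & x = Bgen i]).

(* The values of vs and kap at black nodes play no role. *)
Record admissible : Prop := Admissible {
  admissible_neq0 : forall i, i \notin Ib -> vs i != 0;
  admissible_kap : forall i, i \notin Ib ->
    ~ (ns_node p Ib tau i /\
       forall l, ns_node p Ib tau l -> l != i ->
         (2 %| pairing (coroot p l) (alpha i))%Z) ->
    kap i = 0;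
  admissible_vs_orth : forall i, i \notin Ib ->
    form p (alpha i) (alpha (tau i)) = 0 ->
    refl_word p wb (alpha i) = alpha i -> vs i = vs (tau i);
  admissible_vs_odd : forall i, i \notin Ib -> npar p i ->
    (2 %| form p (alpha i) (alpha (tau i)))%Z ->
    form p (alpha i) (alpha (tau i)) != 0 -> vs i = vs (tau i)
}.

(* The quantum Serre polynomial of an odd node is p_0(x) = x^2. *)
Definition Rem_p0 i : Uq := Bgen i ^+ 2.

End IQuantum.
End Uq.

(* Main.v *)
From mathcomp Require Import all_boot all_order all_algebra all_fingroup.
From mathcomp Require Import boolp reals complex.
From mathcomp Require Import zify ring.
Require Import Defs.

(**
Write X for T_w(E_(tau i)), where w is the longest element of the Weyl group
of the black nodes. An odd node i is white and is never in I_ns, so kappa_i = 0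
and B_i = F_i + varsigma_i X K_i^-1. The squares of F_i, E_(tau i) and X vanish,
and K_i commutes with F_i because (alpha_i, alpha_i) = 0; hence only the cross
term of B_i^2 survives (Rem_p0_cross):
  B_i^2 = varsigma_i (F_i X + X F_i) K_i^-1.

Everything then depends on knowing X. The black nodes adjacent to tau i lie on
one side of it (one_sided_black), so a reduced word in black reflections moves
one of the two basis vectors in alpha_(tau i) monotonically away from the other:
if it ever turned back, two strands of the corresponding permutation would cross
twice and the word could be shortened (reduced_no_uncrossing). Following T_w
letter by letter, X is therefore an iterated q-bracket
  [E_(g r), [.., [E_(g 1), E_(g 0)]]]
along a path of nodes g 0 = tau i, g 1, .., g r whose other vertices are black
(braid_word_root_vector). The letters act on such a bracket through three
rules: a letter away from the path fixes it, the next node of the path extends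
it, and an interior node of the path fixes it, the last by the rank two identity
T_j [E_x, E_j] = E_x for adjacent x and j.

If tau i is not i, then i is not on the path, F_i anticommutes with the bracket,
and B_i^2 = 0. If tau i = i, the condition on rho^vee gives a black neighbour;
the condition w (alpha_j) = - alpha_(tau j) excludes the case where tau is the
reflection of the diagram, and for tau = id the neighbour j is unique and
w (alpha_j) = - alpha_j says exactly that the moving strand stops after one
step. Thus X = [E_j, E_i] and a rank two computation gives the coefficient.
*)

Set Implicit Arguments.
Unset Strict Implicit.
Unset Printing Implicit Defensive.
Import Order.TTheory GRing.Theory Num.Theory.
Local Open Scope ring_scope.

(** * Root data and words in even reflections *)

Section RootSystem.
Variables (N : nat) (p : 'I_N -> bool).
Implicit Types (i j : 'I_N.-1) (a b : 'I_N) (x y h : 'rV[int]_N).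

Lemma alphaE j a : alpha j 0 a = (a == node_l j)%:R - (a == node_r j)%:R.
Proof. by rewrite !mxE eqxx. Qed.

Lemma pairingB h h' x : pairing (h - h') x = pairing h x - pairing h' x.
Proof.
by rewrite /pairing -sumrB; apply: eq_bigr => a _; rewrite !mxE mulrBl.
Qed.

Lemma pairingN h x : pairing (- h) x = - pairing h x.
Proof.
by rewrite /pairing -sumrN; apply: eq_bigr => a _; rewrite mxE mulNr.
Qed.

Lemma pairingZ (c : int) h x : pairing (c *: h) x = c * pairing h x.
Proof.
by rewrite /pairing mulr_sumr; apply: eq_bigr => a _; rewrite !mxE mulrA.
Qed.

Lemma pairing_sum (I : Type) (s : seq I) (P : pred I) (f : I -> 'rV[int]_N) x :
  pairing (\sum_(t <- s | P t) f t) x = \sum_(t <- s | P t) pairing (f t) x.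
Proof.
rewrite /pairing exchange_big; apply: eq_bigr => a _.
by rewrite summxE mulr_suml.
Qed.

Lemma pairing_corootE i x :
  pairing (coroot p i) x = x 0 (node_l i) - (-1) ^+ npar p i * x 0 (node_r i).
Proof.
have delta a c : \sum_b c * (b == a)%:R * x 0 b = c * x 0 a.
  rewrite (bigD1 a) //= eqxx mulr1 big1 ?addr0 // => b /negPf->.
  by rewrite mulr0 mul0r.
rewrite /pairing -[in RHS](mul1r (x 0 (node_l i))) -!delta -sumrB.
by apply: eq_bigr => b _; rewrite !mxE eqxx /= mul1r -mulrBl.
Qed.

Lemma form_alphaE i x :
  form p (alpha i) x = dsym p i * pairing (coroot p i) x.
Proof.
have delta a : \sum_b (-1) ^+ p b * (b == a)%:R * x 0 b = (-1) ^+ p a * x 0 a.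
  rewrite (bigD1 a) //= eqxx mulr1 big1 ?addr0 // => b /negPf->.
  by rewrite mulr0 mul0r.
rewrite pairing_corootE mulrBr mulrA /dsym /npar signr_addb.
rewrite mulrA -signr_addb addbb mul1r -!delta -sumrB.
by apply: eq_bigr => b _; rewrite alphaE mulrBr mulrBl.
Qed.

Lemma form_sym x y : form p x y = form p y x.
Proof. by apply: eq_bigr => a _; rewrite mulrAC. Qed.

Lemma cartanE i j : cartan p i j =
  ((i == j :> nat)%:R - (i == j.+1 :> nat)%:R)
  - (-1) ^+ npar p i * ((i.+1 == j)%:R - (i == j :> nat)%:R).
Proof. by rewrite /cartan pairing_corootE !alphaE -!val_eqE /= eqSS. Qed.

Lemma form_cartan i j : form p (alpha i) (alpha j) = dsym p i * cartan p i j.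
Proof. exact: form_alphaE. Qed.

Lemma adjacentC i j : adjacent i j = adjacent j i.
Proof. by rewrite /adjacent orbC. Qed.

Lemma cartan_adjacent i j : adjacent i j ->
  cartan p i j = if i.+1 == j then - (-1) ^+ npar p i else -1.
Proof.
rewrite cartanE /adjacent => /orP[]/eqP e.
  have [-> -> ->] : [/\ (i == j :> nat) = false, (i == j.+1 :> nat) = false
    & (i.+1 == j :> nat)] by split; lia.
  by rewrite subrr subr0 mulr1 sub0r.
have [-> -> ->] : [/\ (i == j :> nat) = false, (i == j.+1 :> nat)
  & (i.+1 == j :> nat) = false] by split; lia.
by rewrite subrr mulr0 subr0 sub0r.
Qed.

Lemma cartan_diag i : cartan p i i = 1 + (-1) ^+ npar p i.
Proof.
rewrite cartanE eqxx (_ : (i == i.+1 :> nat) = false); last by lia.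
by rewrite (_ : (i.+1 == i) = false) ?subr0 ?sub0r ?mulrN1 ?opprK //; lia.
Qed.

Lemma cartan_even_adjacent i j :
  ~~ npar p i -> adjacent i j -> cartan p i j = -1.
Proof. by move=> /negPf ei /cartan_adjacent->; rewrite ei if_same. Qed.

Lemma cartan_even_diag i : ~~ npar p i -> cartan p i i = 2.
Proof. by move=> /negPf ei; rewrite cartan_diag ei. Qed.

Lemma cartan_odd_diag i : npar p i -> cartan p i i = 0.
Proof. by move=> oi; rewrite cartan_diag oi expr1 subrr. Qed.

Lemma cartan_far i j : j != i -> ~~ adjacent i j -> cartan p i j = 0.
Proof.
rewrite /adjacent -val_eqE cartanE negb_or => /= ij /andP[lij rij].
rewrite eq_sym (negPf ij) (negPf lij) eq_sym (negPf rij).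
by rewrite !subrr mulr0.
Qed.

Lemma cartan_odd_adjacent i j :
  npar p i -> adjacent i j -> cartan p i j = 1 \/ cartan p i j = -1.
Proof.
move=> oi /cartan_adjacent->; rewrite oi expr1 opprK.
by case: ifP; [left|right].
Qed.

Lemma cartan_odd_neq0 i j : npar p i -> cartan p i j <> 0 -> adjacent i j.
Proof.
move=> oi; apply: contra_notT => nij.
case: (eqVneq j i) => [->|ji]; first exact: cartan_odd_diag.
exact: cartan_far.
Qed.

Lemma form_even_adjacent i j :
  ~~ npar p i -> adjacent i j -> form p (alpha i) (alpha j) = - dsym p i.
Proof.
by move=> ei aij; rewrite form_cartan cartan_even_adjacent // mulrN1.
Qed.

(** An even reflection s_i exchanges eps_i and eps_(i+1), so a word in even
    nodes acts on the lattice through this permutation of the basis. *)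
Definition word_perm (w : seq 'I_N.-1) : {perm 'I_N} :=
  foldr (fun i s => s * tperm (node_l i) (node_r i))%g 1%g w.

Lemma word_perm_cons i w a :
  word_perm (i :: w) a = tperm (node_l i) (node_r i) (word_perm w a).
Proof. by rewrite /= permM. Qed.

Lemma word_perm_cat v w : word_perm (v ++ w) = (word_perm w * word_perm v)%g.
Proof. by elim: v => [|i v IHv] /=; rewrite ?mulg1 // IHv mulgA. Qed.

Lemma node_lr i : node_l i != node_r i.
Proof. by rewrite -val_eqE /=; lia. Qed.

Lemma tperm_nodeE i a : tperm (node_l i) (node_r i) a =
  (if a == i :> nat then i.+1
   else if a == i.+1 :> nat then nat_of_ord i else a)
  :> nat.
Proof.
case: tpermP => [->|->|/eqP al /eqP ar] /=; rewrite ?eqxx //.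
  by rewrite (_ : (i.+1 == i :> nat) = false); lia.
by move: al ar; rewrite -!val_eqE /= => /negPf-> /negPf->.
Qed.

Lemma refl_tperm i x : ~~ npar p i ->
  refl p i x = \row_a x 0 (tperm (node_l i) (node_r i) a).
Proof.
move=> /negPf ei; apply/rowP=> a; rewrite /refl pairing_corootE ei mul1r.
rewrite [RHS]mxE mxE [in X in _ + X]mxE [in X in _ - X]mxE alphaE.
have /negPf lr := node_lr i.
case: tpermP => [->|->|/eqP/negPf-> /eqP/negPf->].
- by rewrite eqxx lr /= subr0 mulr1 subKr.
- by rewrite eqxx eq_sym lr /= sub0r mulrN1 opprK addrC subrK.
- by rewrite subrr mulr0 subr0.
Qed.

Lemma refl_word_perm w x : {in w, forall i, ~~ npar p i} ->
  refl_word p w x = \row_a x 0 ((word_perm w)^-1%g a).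
Proof.
elim: w => [|i w IHw] ew /=; first by apply/rowP=> a; rewrite mxE invg1 perm1.
rewrite IHw; last by move=> j jw; apply: ew; rewrite inE jw orbT.
rewrite refl_tperm ?ew ?mem_head //; apply/rowP=> a.
by rewrite !mxE invMg tpermV permM.
Qed.

Lemma refl_word_eps w a : {in w, forall i, ~~ npar p i} ->
  refl_word p w (eps a) = eps (word_perm w a).
Proof.
move=> ew; rewrite refl_word_perm //; apply/rowP=> b; rewrite !mxE !eqxx /=.
by rewrite (canF_eq (permKV _)).
Qed.

Lemma refl_wordB w x y : {in w, forall i, ~~ npar p i} ->
  refl_word p w (x - y) = refl_word p w x - refl_word p w y.
Proof.
by move=> ew; rewrite !refl_word_perm //; apply/rowP=> b; rewrite !mxE.
Qed.

(** A root eps a - eps b determines its ordered pair of strands. *)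
Lemma eps_sub_inj a b c d : a != b ->
  eps a - eps b = eps c - eps d -> a = c /\ b = d.
Proof.
move=> ab e.
have := congr1 (fun x : 'rV[int]_N => x 0 a) e.
have := congr1 (fun x : 'rV[int]_N => x 0 b) e.
rewrite !mxE !eqxx /= (negPf ab) eq_sym (negPf ab).
by do 4!case: eqP => [<-|?] //=; split.
Qed.

(** Only the letter i itself exchanges the positions i and i.+1, the two sides
    of the node i. *)
Lemma word_perm_leq w i a : i \notin w -> (word_perm w a <= i)%N = (a <= i)%N.
Proof.
elim: w => [|j w IHw]; first by rewrite /= perm1.
rewrite inE negb_or -val_eqE /= => /andP[ij iw]; rewrite -(IHw iw).
by rewrite permM tperm_nodeE; do 2?case: eqP; lia.
Qed.

(** Each letter exchanges two neighbouring positions, so two strands can only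
    change their order at a moment when they are neighbours. *)
Lemma word_perm_crossing v a b :
  (a < b)%N -> (word_perm v b < word_perm v a)%N ->
  exists v1 d v2, [/\ v = v1 ++ d :: v2, word_perm v2 a = node_l d
    & word_perm v2 b = node_r d].
Proof.
move=> ab; elim: v => [|e v IHv]; first by rewrite /= !perm1; lia.
case: (ltnP (word_perm v b) (word_perm v a)) => [vba _|].
  have [v1 [d [v2 [-> va vb]]]] := IHv vba; by exists (e :: v1), d, v2.
rewrite leq_eqVlt => /orP[/eqP/val_inj/perm_inj eab|vab].
  by move: ab; rewrite eab ltnn.
rewrite !word_perm_cons => cross; exists [::], e, v.
suff [-> ->]: word_perm v a = node_l e /\ word_perm v b = node_r e by [].
move: vab cross; rewrite !tperm_nodeE => vab.
by do 4?case: eqP => ?; move=> cross; split; apply: val_inj => /=; lia.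
Qed.

(** The exchange condition: if the strands a and b crossed at an earlier letter
    d of v, then c exchanges them back, and deleting both c and d leaves the
    permutation unchanged. *)
Lemma reduced_no_uncrossing (J : {set 'I_N.-1}) u c v a b :
  {in J, forall i, ~~ npar p i} -> reduced p J (u ++ c :: v) -> (a < b)%N ->
  ~ (word_perm v b = node_l c /\ word_perm v a = node_r c).
Proof.
move=> evJ [sub red] ab [vb va].
have [|v1 [d [v2 [ev v2a v2b]]]] := @word_perm_crossing v a b ab.
  by rewrite va vb /=.
have sub' : {subset u ++ v1 ++ v2 <= J}.
  move=> i iw; apply: sub; move: iw.
  by rewrite ev !(mem_cat, inE) => /or3P[] ->; rewrite ?orbT.
have : (size (u ++ c :: v) <= size (u ++ v1 ++ v2))%N.
  apply: red => // x.
  rewrite !refl_word_perm; [|by move=> i /sub/evJ|by move=> i /sub'/evJ].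
  suff -> : word_perm (u ++ c :: v) = word_perm (u ++ v1 ++ v2) by [].
  (* v1 carries the pair of positions that d exchanges to the pair that c
     exchanges, so that s_c v1 s_d = v1. *)
  have v1l : word_perm v1 (node_l d) = node_l c.
    by rewrite -vb ev word_perm_cat permM word_perm_cons v2b tpermR.
  have v1r : word_perm v1 (node_r d) = node_r c.
    by rewrite -va ev word_perm_cat permM word_perm_cons v2a tpermL.
  apply/permP=> z; rewrite !(word_perm_cat u) !(permM _ (word_perm u)).
  rewrite word_perm_cons ev !(word_perm_cat v1) !(permM _ (word_perm v1)).
  rewrite word_perm_cons -v1l -v1r.
  by rewrite -inj_tperm ?tpermK //; apply: perm_inj.
by rewrite ev !size_cat /= size_cat /=; lia.
Qed.
End RootSystem.

(** * q-brackets in an associative algebra *)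

Section QBracket.
Variables (k : fieldType) (A : algType k).
Implicit Types (c b : k) (x y z : A).

Definition qbracket c x y : A := x * y - c *: (y * x).

(** The q-analogue of the Jacobi identity when the outer elements commute. *)
Lemma qbracket_assoc c d x y z : x * z = z * x ->
  qbracket c x (qbracket d y z) = qbracket d (qbracket c x y) z.
Proof.
move=> xz; rewrite /qbracket !mulrBr !mulrBl !scalerBr.
rewrite -!scalerAl -!scalerAr !scalerA (mulrC d c) !mulrA xz.
rewrite -(mulrA y) -(mulrA y) xz !opprB !mulrA.
by rewrite addrACA [RHS]addrACA [X in _ + X]addrC.
Qed.

(** This is how weights, and commutation with generators away from a root
    vector, propagate through iterated brackets. *)
Lemma scomm_qbracket (s t : k) c w x y :
  w * x = s *: (x * w) -> w * y = t *: (y * w) ->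
  w * qbracket c x y = (s * t) *: (qbracket c x y * w).
Proof.
move=> wx wy; rewrite /qbracket mulrBr mulrBl scalerBr.
rewrite -scalerAr -scalerAl mulrA wx mulrA wy.
rewrite -!scalerAl -!mulrA wx wy -!scalerAr !scalerA.
by congr (_ - _ *: _); ring.
Qed.

(** The computation behind T_j [E_x, E_j] = E_x, where E, F, K belong to j, y is
    E_x, and c = q_j^-1. For z = [E, y] one has F z = z F + y K^-1, and
    the weight of z turns the q-bracket with F K into the commutator with F. *)
Lemma rank2_identity c b (E F K K' y : A) :
  c != 0 -> b * (c^-1 - c) = 1 -> K' * K = 1 ->
  K * E = c ^- 2 *: (E * K) -> K * y = c *: (y * K) ->
  K' * y = c^-1 *: (y * K') ->
  F * y = y * F -> E * F = F * E + b *: (K - K') ->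
  qbracket c (qbracket c E y) (- (F * K)) = y.
Proof.
move=> c0 bc K'K KE Ky K'y Fy EF.
have FE : F * E = E * F - b *: (K - K') by rewrite EF addrK.
have KEy : K * qbracket c E y = c^-1 *: (qbracket c E y * K).
  by rewrite (scomm_qbracket _ KE Ky); congr (_ *: _); field.
have Dy : b *: (K - K') * y - c *: (y * (b *: (K - K'))) = - (y * K').
  rewrite -scalerAl -scalerAr mulrBl mulrBr Ky K'y scalerA (mulrC c).
  rewrite -scalerA -scalerBr [c *: (_ - _)]scalerBr opprB addrC addrA subrK.
  by rewrite -scalerBl scalerA -opprB mulrN bc scaleN1r.
have Fz : F * qbracket c E y = qbracket c E y * F + y * K'.
  rewrite -[y * K']opprK -Dy /qbracket mulrBr -scalerAr !mulrA FE Fy.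
  rewrite -(mulrA y) FE !mulrBl !mulrBr -scalerAl.
  rewrite -(mulrA E F y) Fy !mulrA scalerBr !opprB.
  by rewrite -!scalerAl addrACA [RHS]addrACA [- _ - _]addrC.
rewrite {1}/qbracket mulrN mulNr scalerN opprK -mulrA KEy -scalerAr scalerA.
rewrite divff // scale1r !mulrA Fz.
rewrite [(_ + y * K') * K]mulrDl -(mulrA y) K'K mulr1.
by rewrite addKr.
Qed.

Lemma morph_bracket (B : algType k) (f : A -> B) a x y :
  {morph f : x y / x - y} -> {morph f : x y / x * y} ->
  (forall c x, f (c *: x) = c *: f x) ->
  f (x * y - a *: (y * x)) = f x * f y - a *: (f y * f x).
Proof. by move=> fB fM fZ; rewrite fB fZ !fM. Qed.

End QBracket.

Lemma lrmorph_qbracket (k : fieldType) (A B : algType k)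
    (f : {lrmorphism A -> B}) c x y :
  f (qbracket c x y) = qbracket c (f x) (f y).
Proof. by rewrite /qbracket rmorphB [X in _ - X]linearZZ !rmorphM. Qed.

(** * Relations of the quantum superalgebra *)

Section Relations.
Variables (k : fieldType) (q : k) (N : nat) (p : 'I_N -> bool).
Local Notation U := (Uq q p).
Local Notation E := (Egen q p).
Local Notation F := (Fgen q p).
Local Notation K := (Kgen q p).
Local Notation rels := (Urelations q p).
Implicit Types (i j : 'I_N.-1).

Lemma Uq_rel x y : Urel q p x y -> toQ rels x = toQ rels y.
Proof. by move=> xy; apply/toQ_eq; apply: rel_ideal_rel. Qed.

Lemma toQB x y : toQ rels (x - y) = toQ rels x - toQ rels y.
Proof. by rewrite -scaleN1r toQD toQZ scaleN1r. Qed.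

Lemma toQ_bracket a x y : toQ rels (hval (sbracket a x y)) =
  toQ rels (hval x) * toQ rels (hval y)
  - ((-1) ^+ (hpar x && hpar y) * a) *: (toQ rels (hval y) * toQ rels (hval x)).
Proof.
exact: (morph_bracket _ _ _ toQB (@toQM _ _ rels) (@toQZ _ _ rels)).
Qed.

Lemma Kgen0 : K 0 = 1.
Proof. exact: Uq_rel (Urel_K0 q p). Qed.

Lemma KgenD h h' : K (h + h') = K h * K h'.
Proof. by rewrite /Kgen (Uq_rel (Urel_KD q p h h')) toQM. Qed.

Lemma KgenE h i : K h * E i = q ^ pairing h (alpha i) *: (E i * K h).
Proof. by rewrite -toQM (Uq_rel (Urel_KE q p h i)) toQZ toQM. Qed.

Lemma KgenF h i : K h * F i = q ^ (- pairing h (alpha i)) *: (F i * K h).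
Proof. by rewrite -toQM (Uq_rel (Urel_KF q p h i)) toQZ toQM. Qed.

Lemma E_F_comm i j : E i * F j = (-1) ^+ (npar p i && npar p j) *: (F j * E i)
  + (i == j)%:R *: ((qnode q p i - (qnode q p i)^-1)^-1 *:
      (Knode q p i - Knode_inv q p i)).
Proof.
have := Uq_rel (Urel_EF q p i j).
rewrite toQ_bracket mulr1 !toQZ toQB => /(canRL (subrK _)) ->.
exact: addrC.
Qed.

Lemma E_E_comm i j : cartan p i j = 0 ->
  E i * E j = (-1) ^+ (npar p i && npar p j) *: (E j * E i).
Proof.
move=> /(Urel_EE q)/Uq_rel; rewrite toQ_bracket mulr1 toQ0.
by move/eqP; rewrite subr_eq0 => /eqP.
Qed.

Lemma F_F_comm i j : cartan p i j = 0 ->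
  F i * F j = (-1) ^+ (npar p i && npar p j) *: (F j * F i).
Proof.
move=> /(Urel_FF q)/Uq_rel; rewrite toQ_bracket mulr1 toQ0.
by move/eqP; rewrite subr_eq0 => /eqP.
Qed.

Lemma pairing_dsym i (x : 'rV[int]_N) :
  pairing (dsym p i *: coroot p i) x = form p (alpha i) x.
Proof.
rewrite form_alphaE [RHS]big_distrr /=; apply: eq_bigr => a _.
by rewrite !mxE mulrA.
Qed.

Lemma KnodeE i j : Knode q p i * E j
  = q ^ form p (alpha i) (alpha j) *: (E j * Knode q p i).
Proof. by rewrite KgenE pairing_dsym. Qed.

Lemma Knode_invE i j : Knode_inv q p i * E j
  = q ^ (- form p (alpha i) (alpha j)) *: (E j * Knode_inv q p i).
Proof. by rewrite KgenE pairingN pairing_dsym. Qed.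

Lemma Knode_invF i j : Knode_inv q p i * F j
  = q ^ form p (alpha i) (alpha j) *: (F j * Knode_inv q p i).
Proof. by rewrite KgenF pairingN pairing_dsym opprK. Qed.

Lemma KnodeVK i : Knode_inv q p i * Knode q p i = 1.
Proof. by rewrite -KgenD addNr Kgen0. Qed.

Lemma KnodeKV i : Knode q p i * Knode_inv q p i = 1.
Proof. by rewrite -KgenD addrN Kgen0. Qed.

Lemma evenE_E_comm i j : ~~ npar p i -> j != i -> ~~ adjacent i j ->
  E i * E j = E j * E i.
Proof.
move=> /negPf ei ji nij; rewrite E_E_comm ?ei ?scale1r //.
exact: cartan_far.
Qed.

Lemma F_evenE_comm i j : ~~ npar p i -> i != j -> F j * E i = E i * F j.
Proof.
by move=> /negPf ei /negPf ij; rewrite E_F_comm ei ij scale0r addr0 scale1r.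
Qed.

Lemma evenF_E_comm i j : ~~ npar p j -> i != j -> F j * E i = E i * F j.
Proof.
move=> /negPf ej /negPf ij.
by rewrite E_F_comm ej andbF ij scale0r addr0 scale1r.
Qed.

(** * Root vectors along a path and the braid operators *)

Section RootVector.
Variable g : nat -> 'I_N.-1.

(** The root vector of alpha_(g 0) + .. + alpha_(g r); each step is the formula
    for T_(g r) on an adjacent generator. *)
Fixpoint root_vector r : U :=
  if r is r'.+1 then
    qbracket (q ^ form p (alpha (g r)) (alpha (g r')))
      (E (g r)) (root_vector r')
  else E (g 0%N).

Lemma root_vector0 : root_vector 0 = E (g 0%N).
Proof. by []. Qed.

Lemma root_vectorS r : root_vector r.+1 =
  qbracket (q ^ form p (alpha (g r.+1)) (alpha (g r)))
    (E (g r.+1)) (root_vector r).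
Proof. by []. Qed.

Lemma root_vector_scomm (s : nat -> k) w r :
  (forall t, (t <= r)%N -> w * E (g t) = s t *: (E (g t) * w)) ->
  w * root_vector r = (\prod_(t < r.+1) s t) *: (root_vector r * w).
Proof.
elim: r => [|r IHr] wE; first by rewrite big_ord1 /= wE.
rewrite big_ord_recr /= mulrC; apply: scomm_qbracket; first exact: wE.
by apply: IHr => t tr; apply/wE/leqW.
Qed.

Lemma E_root_vector_far i r : ~~ npar p i ->
  (forall t, (t <= r)%N -> g t != i /\ ~~ adjacent i (g t)) ->
  E i * root_vector r = root_vector r * E i.
Proof.
move=> ei far; rewrite (@root_vector_scomm (fun=> 1)) ?big1 ?scale1r //.
by move=> t /far[gti nadj]; rewrite scale1r evenE_E_comm.
Qed.

Variable T : 'I_N.-1 -> {lrmorphism U -> U}.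
Hypothesis hT : forall i, ~~ npar p i -> braid_operator i (T i).

Lemma braid_qbracket i c x y :
  T i (qbracket c x y) = qbracket c (T i x) (T i y).
Proof. exact: lrmorph_qbracket. Qed.

Lemma braid_root_vector_far i r : ~~ npar p i ->
  (forall t, (t <= r)%N -> g t != i /\ ~~ adjacent i (g t)) ->
  T i (root_vector r) = root_vector r.
Proof.
move=> ei; elim: r => [|r IHr] far.
  by have [? ?] := far 0%N isT; apply: (braid_E_far (hT ei)).
have [gi nadj] := far r.+1 (leqnn _).
rewrite root_vectorS braid_qbracket (braid_E_far (hT ei) gi nadj) IHr => [//|].
by move=> t tr; apply/far/leqW.
Qed.

(* g 0, .., g L is an induced path of the diagram. *)
Variable L : nat.
Hypothesis g_eq : forall s t, (s <= L)%N -> (t <= L)%N ->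
  (g s == g t) = (s == t).
Hypothesis g_adj : forall s t, (s <= L)%N -> (t <= L)%N ->
  adjacent (g s) (g t) = (s.+1 == t) || (t.+1 == s).

Lemma path_far s r : (r < s)%N -> (s < L)%N ->
  forall t, (t <= r)%N -> g t != g s.+1 /\ ~~ adjacent (g s.+1) (g t).
Proof. by move=> rs sL t tr; rewrite g_eq ?g_adj; lia. Qed.

(** T_(g r.+1) only changes the outermost generator E_(g r), into a bracket with
    E_(g r.+1), which qbracket_assoc moves to the outside. *)
Lemma braid_root_vector_succ r : (r < L)%N -> ~~ npar p (g r.+1) ->
  T (g r.+1) (root_vector r) = root_vector r.+1.
Proof.
move=> rL er; have adj : adjacent (g r.+1) (g r) by rewrite g_adj; lia.
case: r rL er adj => [|r] rL er adj; first exact: (braid_E_adj (hT er)).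
rewrite root_vectorS braid_qbracket (braid_E_adj (hT er) adj).
rewrite (braid_root_vector_far er (path_far (leqnn _) rL)).
rewrite [RHS]root_vectorS root_vectorS.
rewrite [RHS]qbracket_assoc; first by [].
exact: (E_root_vector_far er (path_far (leqnn _) rL)).
Qed.

Hypotheses (q0 : q != 0) (q2 : q ^+ 2 != 1).

Lemma qnode_neq0 i : qnode q p i != 0.
Proof. exact: expfz_neq0. Qed.

Lemma qnode_sub_neq0 i : qnode q p i - (qnode q p i)^-1 != 0.
Proof.
have qV : q - q^-1 != 0.
  by apply: contraNneq q2 => /subr0_eq qq; rewrite expr2 {1}qq mulVf.
rewrite /qnode /dsym; case: (p _); rewrite ?expr0 ?expr1 //.
by rewrite -opprB invrK oppr_eq0.
Qed.

Lemma braid_E_bracket i j : ~~ npar p i -> adjacent i j -> j != i ->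
  T i (qbracket (q ^ form p (alpha j) (alpha i)) (E j) (E i)) = E j.
Proof.
move=> ei adj ji; have fij : q ^ form p (alpha i) (alpha j) = (qnode q p i)^-1.
  by rewrite form_even_adjacent // invr_expz.
have fii : q ^ form p (alpha i) (alpha i) = (qnode q p i)^-1 ^- 2.
  by rewrite form_cartan cartan_even_diag // -exprz_exp exprVn invrK.
rewrite braid_qbracket (braid_Ei (hT ei)) (braid_E_adj (hT ei) adj).
rewrite (form_sym p (alpha j)) fij.
apply: (rank2_identity _ _ (KnodeVK i)).
- by rewrite invr_eq0 qnode_neq0.
- by rewrite invrK; apply: mulVf; apply: qnode_sub_neq0.
- by rewrite KnodeE fii.
- by rewrite KnodeE fij.
- by rewrite Knode_invE -invr_expz fij.
- exact: evenF_E_comm.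
- by rewrite E_F_comm (negPf ei) eqxx !scale1r.
Qed.

(** With j = g t and x = g t.+1, the vector of level t.+1 is [[E_x, E_j], X]
    with X of level t.-1. Now T_j sends [E_x, E_j] to E_x and X to [E_j, X],
    which gives back [E_x, [E_j, X]]; T_j fixes the generators beyond x. *)
Lemma braid_root_vector_interior r t : (0 < t < r)%N -> (r <= L)%N ->
  (forall s, (0 < s <= r)%N -> ~~ npar p (g s)) ->
  T (g t) (root_vector r) = root_vector r.
Proof.
case: t => // t; elim: r => // r IHr tr rL ev.
have et : ~~ npar p (g t.+1) by apply: ev; lia.
have [tr'|rt] := ltnP t.+1 r.
  have gr : g r.+1 != g t.+1 by rewrite g_eq; lia.
  have nadj : ~~ adjacent (g t.+1) (g r.+1) by rewrite g_adj; lia.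
  rewrite root_vectorS braid_qbracket (braid_E_far (hT et) gr nadj).
  rewrite IHr => [//|||].
  - by rewrite tr'.
  - exact: ltnW.
  - by move=> s sr; apply: ev; lia.
have {rt tr} er : r = t.+1 by lia.
rewrite {}er in rL IHr ev *.
have gt : g t.+2 != g t.+1 by rewrite g_eq; lia.
have adj2 : adjacent (g t.+1) (g t.+2) by rewrite g_adj; lia.
have adj1 : adjacent (g t.+1) (g t) by rewrite g_adj; lia.
(* Both scalars are q_j^-1 for the even node j = g t.+1; this is what lets the
   two brackets be regrouped into the original one. *)
have fE : form p (alpha (g t.+2)) (alpha (g t.+1))
    = form p (alpha (g t.+1)) (alpha (g t)).
  by rewrite form_sym !form_even_adjacent.
have comm : E (g t.+2) * root_vector t = root_vector t * E (g t.+2).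
  by apply: (E_root_vector_far (ev _ _) (path_far _ _)); lia.
rewrite [in LHS]root_vectorS [in LHS]root_vectorS.
rewrite (qbracket_assoc _ _ _ comm) braid_qbracket (braid_E_bracket et adj2 gt).
rewrite braid_root_vector_succ; [|lia|exact: et].
by rewrite [RHS]root_vectorS fE.
Qed.

End RootVector.
End Relations.

(** * Diagrams with an odd node *)

Section Satake.
Variables (N : nat) (p : 'I_N -> bool).
Variables (Ib : {set 'I_N.-1}) (tau : 'I_N.-1 -> 'I_N.-1) (wb : seq 'I_N.-1).
Implicit Types i j : 'I_N.-1.
Hypothesis satake : super_satake p Ib tau wb.
Hypothesis wbJ : {subset wb <= Ib}.

Let even_Ib := satake_even satake.
Let even_wb : {in wb, forall i, ~~ npar p i}.
Proof. by move=> i /wbJ/even_Ib. Qed.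

Lemma word_perm_satake j : j \in Ib ->
  word_perm wb (node_l j) = node_r (tau j)
  /\ word_perm wb (node_r j) = node_l (tau j).
Proof.
move=> jb; have := satake_w satake jb.
rewrite /alpha refl_wordB // !refl_word_eps // opprB => /eps_sub_inj[|-> -> //].
by rewrite (inj_eq perm_inj) eq_sym node_lr.
Qed.

(** The group of the black nodes preserves the basis vectors on either side of
    a white node, while w maps the strands of j to those of tau j. Hence tau
    keeps a black node on the same side of every white node. *)
Lemma white_separates i j : i \notin Ib -> j \in Ib ->
  (j < i)%N = (tau j < i)%N.
Proof.
move=> iw jb; have [_ tj] := word_perm_satake jb.
have iwb : i \notin wb by apply: contra iw => /wbJ.
have ti : tau j != i.
  by apply: contra iw => /eqP<-; rewrite -(satake_stable satake) imset_f.
have := word_perm_leq (node_r j) iwb; rewrite tj /= => <-.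
by rewrite ltn_neqAle val_eqE ti.
Qed.

(** If no black node were adjacent to i, then alpha_i would be orthogonal to
    every black coroot, hence to rho^vee. *)
Lemma black_neighbour i : npar p i -> tau i = i ->
  exists2 j, j \in Ib & adjacent i j.
Proof.
move=> oi ti; apply/exists_inP; apply: contraT; rewrite negb_exists_in.
move=> /forall_inP nadj.
have iw : i \notin Ib by apply: contraTN oi; apply: even_Ib.
have coroot0 j : j \in Ib -> pairing (coroot p j) (alpha i) = 0.
  move=> jb; apply: cartan_far; last by rewrite adjacentC nadj.
  by apply: contraNneq iw => ->.
have := satake_white_odd satake iw oi ti.
rewrite /rhov_pairing /two_rhov pairing_sum big1 ?mul0r ?eqxx //.
move=> [a b] /= /andP[_ /asboolP[w [j [wI jb ->]]]].
elim: w wI => [_|e w IHw wI] /=; first exact: coroot0.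
rewrite /reflv pairingB pairingZ IHw; last first.
  by move=> z zw; apply: wI; rewrite inE zw orbT.
by rewrite coroot0 ?mulr0 ?subr0 // wI ?mem_head.
Qed.

(** The reflection of the diagram would move a black neighbour of its fixed node
    i to the other side of i, against white_separates; so tau = id. *)
Lemma fixed_odd_node i : npar p i -> tau i = i ->
  exists j, [/\ j \in Ib, adjacent i j, tau j = j &
    forall j', j' \in Ib -> adjacent i j' -> j' = j].
Proof.
move=> oi ti; have [j jb adj] := black_neighbour oi ti.
have iw : i \notin Ib by apply: contraTN oi; apply: even_Ib.
have tid : tau =1 id.
  case: (satake_sym satake) => // trev.
  have := white_separates iw jb; have := congr1 val (trev i).
  rewrite ti trev /=; move: adj; rewrite /adjacent.
  have := ltn_ord i; have := ltn_ord j; lia.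
have /eqP/cards1P[j0 J] := satake_id_odd satake tid oi.
have uniq j' : j' \in Ib -> adjacent i j' -> j' = j0.
  by move=> jb' adj'; apply/set1P; rewrite -J inE jb'.
exists j; split=> // j' jb' adj'.
by rewrite (uniq j') // (uniq j).
Qed.

(** Since tau keeps the two sides of a white node apart and in place, while the
    reflection of the diagram reverses the order of the nodes, tau i cannot have
    black nodes on both sides when tau is the reflection. *)
Lemma one_sided_black i : npar p i -> exists d : bool, forall j, j \in Ib ->
  adjacent (tau i) j -> if d then (j < tau i)%N else (tau i < j)%N.
Proof.
move=> oi; case: (eqVneq (tau i) i) => [ti|ti].
  have [j [jb adj _ uniq]] := fixed_odd_node oi ti; exists (j < i)%N => j' jb'.
  rewrite ti => /(uniq _ jb')->; case: ifP => // /negbT.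
  by move: adj; rewrite /adjacent; lia.
have trev : tau =1 @rev_ord N.-1.
  by case: (satake_sym satake) => // tid; rewrite tid eqxx in ti.
have tiw : tau i \notin Ib.
  by apply: contraTN oi => /even_Ib; rewrite (satake_par satake).
exists [exists j in Ib, (j.+1 == tau i :> nat)] => j jb adj.
case: exists_inP => [[l lb /eqP lk]|nl].
  have := white_separates tiw lb; have := white_separates tiw jb.
  move: adj; rewrite /adjacent (trev j) (trev l) /=.
  have := ltn_ord j; have := ltn_ord (tau i); lia.
move: adj => /orP[/eqP<- //|/eqP jk]; case: nl.
by exists j => //; apply/eqP.
Qed.

End Satake.

(** * Following one strand through a reduced word *)

Section Ray.
Variables (N : nat) (d : bool) (k : 'I_N.-1).

(** The nodes from k outwards, to the left if d and to the right otherwise.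
    The default value k is only taken beyond ray_length. *)
Definition ray t : 'I_N.-1 := insubd k (if d then k - t else k + t)%N.
Definition ray_length : nat := if d then nat_of_ord k else (N.-2 - k)%N.

(** The end of alpha_j on the side of d: the strand that moves away when
    reflections on that side are applied to alpha_k. *)
Definition strand (j : 'I_N.-1) : 'I_N := if d then node_l j else node_r j.

Lemma val_ray t : (t <= ray_length)%N ->
  ray t = (if d then k - t else k + t)%N :> nat.
Proof.
move=> tL; rewrite val_insubd ifT //.
by move: tL; rewrite /ray_length; have := ltn_ord k; case: d; lia.
Qed.

Lemma ray0 : ray 0 = k.
Proof. by apply: val_inj; rewrite /= val_ray ?subn0 ?addn0 ?if_same. Qed.

Lemma ray_eq s t : (s <= ray_length)%N -> (t <= ray_length)%N ->
  (ray s == ray t) = (s == t).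
Proof.
move=> sL tL; rewrite -val_eqE /= !val_ray //; move: sL tL.
by rewrite /ray_length; case: d; lia.
Qed.

Lemma ray_adjacent s t : (s <= ray_length)%N -> (t <= ray_length)%N ->
  adjacent (ray s) (ray t) = (s.+1 == t) || (t.+1 == s).
Proof.
move=> sL tL; rewrite /adjacent !val_ray //; move: sL tL.
by rewrite /ray_length; case: d; lia.
Qed.

Lemma ray_onto (j : 'I_N.-1) : (if d then (j < k)%N else (k < j)%N) ->
  exists t, [/\ (0 < t)%N, (t <= ray_length)%N & j = ray t].
Proof.
have := ltn_ord j; rewrite /ray_length => jN side.
exists (if d then k - j else j - k)%N.
have tL : ((if d then k - j else j - k) <= ray_length)%N.
  by rewrite /ray_length; case: d side; lia.
split=> //; first by case: d side; lia.
by apply: val_inj; rewrite /= val_ray //; case: d side; lia.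
Qed.
End Ray.

Section Track.
Variables (N : nat) (p : 'I_N -> bool).
Variables (J : {set 'I_N.-1}) (d : bool) (k : 'I_N.-1).
Hypothesis evJ : {in J, forall i, ~~ npar p i}.
Hypothesis kJ : k \notin J.
Hypothesis side : forall j, j \in J -> adjacent k j ->
  if d then (j < k)%N else (k < j)%N.
Local Notation g := (ray d k).
Local Notation L := (ray_length d k).
Implicit Types i j : 'I_N.-1.

(** At such a letter j the moving strand would step back, exchanging places with
    a strand y that lies on the inner side of j. That strand started further
    out, since no letter crosses the node k, so the two have crossed before. *)
Lemma strand_no_return u j v r : reduced p J (u ++ j :: v) ->
  (0 < r <= L)%N -> j = g r -> word_perm v (strand d k) <> strand d j.
Proof.
move=> red /andP[r0 rL] jr vk.
have kv : k \notin v.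
  have [sub _] := red; apply: contra kJ => kv.
  by apply: sub; rewrite mem_cat inE kv !orbT.
have jN : j = (if d then k - r else k + r)%N :> nat by rewrite jr val_ray.
pose y := (word_perm v)^-1%g (if d then node_r j else node_l j).
have vy : word_perm v y = if d then node_r j else node_l j by rewrite permKV.
have yk : y != strand d k.
  rewrite -(inj_eq (@perm_inj _ (word_perm v))) vy vk /strand.
  by case: (d); rewrite ?node_lr // eq_sym node_lr.
have yside := word_perm_leq y kv.
move: yk yside vy vk jN rL; rewrite /strand /ray_length.
case: (d) => yk yside vy vk jN rL.
  apply: (reduced_no_uncrossing evJ red _ (conj vk vy)).
  by move: yk yside; rewrite vy -val_eqE /= jN; lia.
apply: (reduced_no_uncrossing evJ red _ (conj vy vk)).
by move: yk yside; rewrite vy -val_eqE /= jN; lia.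
Qed.

Lemma strand_far i j : i != j -> ~~ adjacent j i ->
  tperm (node_l j) (node_r j) (strand d i) = strand d i.
Proof.
rewrite /adjacent -val_eqE /= => ij nadj.
by rewrite tpermD // -val_eqE /= /strand; case: (d) => /=; lia.
Qed.

Lemma strand_step r : (r < L)%N ->
  tperm (node_l (g r.+1)) (node_r (g r.+1)) (strand d (g r))
  = strand d (g r.+1).
Proof.
move=> rL; apply: val_inj; rewrite /= tperm_nodeE /strand.
have := val_ray rL; have := val_ray (ltnW rL); move: rL.
by rewrite /ray_length; case: (d) => /= rL gr gr1; do 2?case: eqP => ? /=; lia.
Qed.

Variables (k0 : fieldType) (q : k0).
Hypotheses (q0 : q != 0) (q2 : q ^+ 2 != 1).
Local Notation U := (Uq q p).
Variable T : 'I_N.-1 -> {lrmorphism U -> U}.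
Hypothesis hT : forall i, ~~ npar p i -> braid_operator i (T i).

Lemma braid_word_cons j v (x : U) :
  braid_word T (j :: v) x = T j (braid_word T v x).
Proof. by []. Qed.

(** The strand that starts at the end of alpha_k records how far along the ray
    the root vector has grown. The word is read from its last letter, which acts
    first; u is the part still to be applied, kept so that reducedness refers to
    the whole word. *)
Lemma braid_word_root_vector u v : reduced p J (u ++ v) ->
  exists r, [/\ (r <= L)%N, forall t, (0 < t <= r)%N -> g t \in J,
    braid_word T v (Egen q p k) = root_vector q p g r
    & word_perm v (strand d k) = strand d (g r)].
Proof.
elim: v u => [|j v IHv] u red.
  exists 0%N; rewrite /= perm1 ray0; split=> [//|t|//|//].
  by case: t.
have [r [rL gJ Tv pv]] : exists r, [/\ (r <= L)%N,
    forall t, (0 < t <= r)%N -> g t \in J,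
    braid_word T v (Egen q p k) = root_vector q p g r
    & word_perm v (strand d k) = strand d (g r)].
  by apply: (IHv (rcons u j)); rewrite cat_rcons.
have jJ : j \in J.
  by case: red => sub _; apply: sub; rewrite mem_cat mem_head orbT.
have ej := evJ jJ.
have jk : j != k by apply: contraNneq kJ => <-.
rewrite braid_word_cons Tv word_perm_cons pv.
have ge := @ray_eq N d k; have ga := @ray_adjacent N d k.
have keep : T j (root_vector q p g r) = root_vector q p g r ->
    tperm (node_l j) (node_r j) (strand d (g r)) = strand d (g r) ->
    exists r', [/\ (r' <= L)%N, forall t, (0 < t <= r')%N -> g t \in J,
      T j (root_vector q p g r) = root_vector q p g r' &
      tperm (node_l j) (node_r j) (strand d (g r)) = strand d (g r')].
  by move=> h1 h2; exists r.
case: (boolP (if d then (j < k)%N else (k < j)%N)) => [/ray_onto|far];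
    last first.
  have nadj t : (t <= r)%N -> g t != j /\ ~~ adjacent j (g t).
    move=> tr; have gt := val_ray (leq_trans tr rL).
    have nadjk : ~~ adjacent k j by apply: contra far => /(side jJ).
    move: jk nadjk far gt; rewrite /adjacent -!val_eqE /=.
    by case: (d) => /=; lia.
  apply: keep; first exact: (braid_root_vector_far hT ej nadj).
  have [ngr nadjr] := nadj r (leqnn r).
  exact: strand_far.
case=> t [t0 tL jt].
have [tr|rt|tr] := ltngtP t r.
- apply: keep.
    rewrite jt; apply: (braid_root_vector_interior hT ge ga q0 q2) => //.
    + by rewrite t0.
    + by move=> s sr; apply/evJ/gJ.
  have := val_ray tL; have := val_ray rL; move: rL.
  rewrite /ray_length => rL' gr gt.
  by rewrite tpermD // jt -val_eqE /= /strand; case: (d) rL' gr gt => /=; lia.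
- have [tr1|rt1] := eqVneq t r.+1.
    exists r.+1; rewrite jt tr1 in ej jJ *; rewrite tr1 in tL; split=> //.
    + move=> s /andP[s0]; rewrite leq_eqVlt => /orP[/eqP->//|sr].
      by apply: gJ; rewrite s0.
    + exact: (braid_root_vector_succ hT ge ga).
    + exact: strand_step.
  have nadj s : (s <= r)%N -> g s != j /\ ~~ adjacent j (g s).
    by move=> sr; rewrite jt ge ?ga; lia.
  apply: keep; first exact: (braid_root_vector_far hT ej nadj).
  by have [ngr nadjr] := nadj r (leqnn r); apply: strand_far.
- rewrite tr in t0 tL jt.
  by case: (strand_no_return red _ jt); rewrite ?t0 // jt pv.
Qed.
End Track.

(** * The square of B_i *)

Section Squares.
Variables (k : fieldType) (A : algType k).

Lemma anticomm_self_eq0 (x : A) : 2 != 0 :> k ->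
  x * x = (-1) *: (x * x) -> x * x = 0.
Proof.
move=> two0 /eqP; rewrite scaleN1r -addr_eq0 -mulr2n -scaler_nat scaler_eq0.
by rewrite (negPf two0) => /eqP.
Qed.

Lemma square_expansion (c v : k) (F X K : A) :
  F * F = 0 -> X * X = 0 -> K * F = F * K -> K * X = c *: (X * K) ->
  (F + v *: (X * K) + 0 *: K) ^+ 2 = v *: ((F * X + X * F) * K).
Proof.
move=> FF XX KF KX; rewrite scale0r addr0 expr2 mulrDl !mulrDr FF add0r.
rewrite -!scalerAr -!scalerAl -!mulrA KF (mulrA K) KX.
rewrite -scalerAl -scalerAr !mulrA XX !mul0r !scaler0 addr0.
by rewrite -mulrA mulrDl scalerDr !mulrA.
Qed.

(** With F, E odd and y even, F X + X F = y H - e H y for X = [y, E] and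
    H = F E + E F = b (K - K^-1); the terms in K^-1 cancel. *)
Lemma odd_cross_term (b e : k) (F E K K' y : A) :
  e != 0 -> K * K' = 1 -> K * y = e *: (y * K) -> K' * y = e^-1 *: (y * K') ->
  F * y = y * F -> E * F = (-1) *: (F * E) + b *: (K - K') ->
  (F * qbracket e y E + qbracket e y E * F) * K' = (b * (1 - e ^+ 2)) *: y.
Proof.
move=> e0 KK' Ky K'y Fy EF.
have H : F * E + E * F = b *: (K - K') by rewrite EF scaleN1r addNKr.
have -> : F * qbracket e y E + qbracket e y E * F
    = y * (F * E + E * F) - e *: ((F * E + E * F) * y).
  rewrite /qbracket mulrBr mulrBl -scalerAr -scalerAl !mulrA Fy.
  rewrite -(mulrA E y F) -Fy addrACA -opprD -scalerDr.
  by rewrite mulrDr mulrDl !mulrA Fy.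
rewrite H -scalerAl -scalerAr [y * (K - K')]mulrBr [(K - K') * y]mulrBl Ky K'y.
have ebe : e * b / e = b by field.
rewrite !scalerBr !scalerA ebe opprB addrA subrK.
rewrite -scalerBl -scalerAl -(mulrA y) KK' mulr1.
by congr (_ *: _); ring.
Qed.
End Squares.

Section Main.
Variables (k : fieldType) (q : k) (N : nat) (p : 'I_N -> bool).
Hypotheses (q0 : q != 0) (q2 : q ^+ 2 != 1) (two0 : 2 != 0 :> k).
Local Notation U := (Uq q p).
Local Notation E := (Egen q p).
Local Notation F := (Fgen q p).
Variable T : 'I_N.-1 -> {lrmorphism U -> U}.
Hypothesis hT : forall i, ~~ npar p i -> braid_operator i (T i).
Implicit Types i j : 'I_N.-1.

Lemma F_odd_sqr i : npar p i -> F i * F i = 0.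
Proof.
move=> oi; apply: (anticomm_self_eq0 two0).
by have := F_F_comm q (cartan_odd_diag oi); rewrite oi.
Qed.

Lemma E_odd_sqr i : npar p i -> E i * E i = 0.
Proof.
move=> oi; apply: (anticomm_self_eq0 two0).
by have := E_E_comm q (cartan_odd_diag oi); rewrite oi.
Qed.

Lemma braidM i x y : T i (x * y) = T i x * T i y.
Proof. exact: rmorphM. Qed.

Lemma braid0 i : T i 0 = 0.
Proof. exact: raddf0. Qed.

Lemma braid_word_sqr0 w (x : U) : x * x = 0 ->
  braid_word T w x * braid_word T w x = 0.
Proof.
move=> xx; elim: w => [|j w IHw]; first exact: xx.
by rewrite !braid_word_cons -braidM IHw braid0.
Qed.

Lemma F_root_vector_odd g i r : npar p i -> npar p (g 0%N) ->
  (forall t, (t <= r)%N -> g t != i) ->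
  (forall t, (0 < t <= r)%N -> ~~ npar p (g t)) ->
  F i * root_vector q p g r = (-1) *: (root_vector q p g r * F i).
Proof.
move=> oi o0 neq ev.
rewrite (@root_vector_scomm _ _ _ _ g (fun t => if t == 0%N then -1 else 1)).
  by rewrite big_ord_recl big1 ?mulr1.
move=> t tr; have gi := neq t tr; case: eqP => [t0|/eqP t0].
  rewrite t0 in gi *; rewrite (E_F_comm q p (g 0%N) i) o0 oi (negPf gi).
  by rewrite scale0r addr0 scalerA mulrNN mulr1 scale1r.
by rewrite scale1r; apply: F_evenE_comm => //; apply: ev; rewrite lt0n t0.
Qed.

Variables (Ib : {set 'I_N.-1}) (tau : 'I_N.-1 -> 'I_N.-1) (wb : seq 'I_N.-1).
Variables (vs kap : 'I_N.-1 -> k).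
Hypothesis satake : super_satake p Ib tau wb.
Hypothesis red : reduced p Ib wb.
Hypothesis adm : admissible p Ib tau wb vs kap.

Lemma odd_white i : npar p i -> i \notin Ib.
Proof. by apply: contraTN; apply: (satake_even satake). Qed.

(** An odd node fixed by tau has a black neighbour, hence is not in I_ns. *)
Lemma odd_kap0 i : npar p i -> kap i = 0.
Proof.
move=> oi; apply: (admissible_kap adm (odd_white oi)) => -[/and3P[_ /eqP ti]].
have [j [jb adj _ _]] := fixed_odd_node satake red.1 oi ti.
move=> /forall_inP/(_ j jb); rewrite -/(cartan p j i).
by rewrite cartan_even_adjacent ?(satake_even satake) // adjacentC.
Qed.

Lemma braid_word_odd i : npar p i -> exists d r, let g := ray d (tau i) in
  [/\ forall j, j \in Ib -> adjacent (tau i) j ->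
       if d then (j < tau i)%N else (tau i < j)%N,
     (r <= ray_length d (tau i))%N, forall t, (0 < t <= r)%N -> g t \in Ib,
     braid_word T wb (E (tau i)) = root_vector q p g r
   & word_perm wb (strand d (tau i)) = strand d (g r)].
Proof.
move=> oi; have [d side] := one_sided_black satake red.1 oi.
have oti : npar p (tau i) by rewrite (satake_par satake).
have [r [? ? ? ?]] := braid_word_root_vector (satake_even satake)
  (odd_white oti) side q0 q2 hT (u := [::]) red.
by exists d, r.
Qed.

Lemma Rem_p0_cross i : npar p i -> Rem_p0 T tau wb vs kap i =
  vs i *: ((F i * braid_word T wb (E (tau i))
            + braid_word T wb (E (tau i)) * F i) * Knode_inv q p i).
Proof.
move=> oi; have oti : npar p (tau i) by rewrite (satake_par satake).
have [d [r [_ _ _ Tw _]]] := braid_word_odd oi.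
pose s t := q ^ (- form p (alpha i) (alpha (ray d (tau i) t))).
have KX := @root_vector_scomm _ q _ p _ s _ r (fun t _ => Knode_invE q p i _).
rewrite -Tw in KX; rewrite /Rem_p0 /Bgen (odd_kap0 oi).
apply: (square_expansion _ (F_odd_sqr oi) _ _ KX).
  exact: (braid_word_sqr0 wb (E_odd_sqr oti)).
have fii : q ^ form p (alpha i) (alpha i) = 1.
  by rewrite form_cartan cartan_odd_diag // mulr0 expr0z.
by rewrite Knode_invF fii scale1r.
Qed.

(** No vertex of the path from tau i equals i, as the others are black; so F_i
    commutes or anticommutes with each generator in the root vector. *)
Lemma Rem_p0_not_fixed i : npar p i -> tau i != i ->
  Rem_p0 T tau wb vs kap i = 0.
Proof.
move=> oi ti; rewrite (Rem_p0_cross oi).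
have [d [r [_ rL gI -> _]]] := braid_word_odd oi.
rewrite F_root_vector_odd //.
- by rewrite scaleN1r addNr mul0r scaler0.
- by rewrite ray0 (satake_par satake).
- move=> t tr; case: (posnP t) => [->|t0]; first by rewrite ray0.
  by apply: contraNneq (odd_white oi) => <-; apply: gI; rewrite t0.
- by move=> t tr; apply: (satake_even satake); apply: gI.
Qed.

(** For a = 1 this is (1 - z^2) / (z - z^-1) = - z, and for a = -1 it is
    (1 - z^-2) / (z - z^-1) = z^-1. *)
Lemma qnode_factor i (a : int) : a = 1 \/ a = -1 ->
  (qnode q p i - (qnode q p i)^-1)^-1 * (1 - (qnode q p i ^ a) ^+ 2)
  = - (a%:~R * qnode q p i ^ a).
Proof.
have z0 := qnode_neq0 p q0 i; have zz := qnode_sub_neq0 p q0 q2 i.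
set z := qnode q p i in z0 zz *.
have z2 : z ^+ 2 - 1 != 0.
  apply: contraNneq zz => z2.
  by rewrite -(mulfK z0 (z - _)) mulrBl mulVf // -expr2 z2 mul0r.
by case=> ->; rewrite ?expr1z ?exprN1 ?mulrN1z ?mulr1z; field; rewrite ?z0 ?z2.
Qed.

Lemma Rem_p0_fixed i j : npar p i -> tau i = i -> j \in Ib -> adjacent i j ->
  Rem_p0 T tau wb vs kap i =
  - ((cartan p i j)%:~R * qnode q p i ^ cartan p i j * vs i) *: E j.
Proof.
move=> oi ti jb adj; rewrite (Rem_p0_cross oi).
have [d [r]] := braid_word_odd oi; rewrite ti => -[side rL gI -> pw].
have [j' [jb' adj' tj' uniq]] := fixed_odd_node satake red.1 oi ti.
rewrite -(uniq j jb adj) in tj'.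
have [wl wr] := word_perm_satake satake red.1 jb; rewrite tj' in wl wr.
have sidej := side j jb adj.
(* The moving strand of alpha_i is the one shared with alpha_j, and w exchanges
   the two strands of alpha_j. *)
have wj : word_perm wb (strand d i) = strand d j.
  move: sidej adj; rewrite /strand /adjacent.
  case: (d) => ji adj''; [rewrite -wr|rewrite -wl]; congr (word_perm wb _);
    by apply: val_inj => /=; lia.
have jr : j = ray d i r.
  apply: val_inj; move: pw; rewrite wj /strand; case: (d) => /(congr1 val) //=.
  by case.
have r1 : r = 1%N.
  have := val_ray rL; rewrite -jr; move: sidej adj rL.
  by rewrite /adjacent /ray_length; case: (d); lia.
rewrite r1 root_vectorS -[in ray d i 1]r1 -jr root_vector0 ray0.
have ej := satake_even satake jb.
have ji : j != i by apply: contraNneq ej => ->.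
pose e := q ^ form p (alpha i) (alpha j).
have e0 : e != 0 by exact: expfz_neq0.
have K'E : Knode_inv q p i * E j = e^-1 *: (E j * Knode_inv q p i).
  by rewrite Knode_invE -invr_expz.
have FE : E i * F i = (-1) *: (F i * E i)
    + (qnode q p i - (qnode q p i)^-1)^-1 *: (Knode q p i - Knode_inv q p i).
  by rewrite E_F_comm oi eqxx scale1r.
rewrite (form_sym p (alpha j)).
rewrite (odd_cross_term e0 (KnodeKV q p i) (KnodeE q p i j) K'E
  (F_evenE_comm q ej ji) FE) scalerA.
have -> : e = qnode q p i ^ cartan p i j by rewrite /e form_cartan -exprz_exp.
rewrite (qnode_factor _ (cartan_odd_adjacent oi adj)).
rewrite [X in X *: _](_ : _
  = - ((cartan p i j)%:~R * qnode q p i ^ cartan p i j * vs i)); first by [].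
by rewrite mulrN mulrC.
Qed.

Theorem Rem_p0_odd i : npar p i ->
  [/\ Ui T Ib tau wb vs kap (Rem_p0 T tau wb vs kap i),
      tau i = i -> exists! j, j \in Ib /\ cartan p i j <> 0
    & forall j, (tau i = i -> j \in Ib /\ cartan p i j <> 0) ->
      Rem_p0 T tau wb vs kap i =
        - ((i == tau i)%:R * (cartan p i j)%:~R
           * qnode q p i ^ cartan p i j * vs i) *: E j].
Proof.
move=> oi; split.
- rewrite /Rem_p0 expr2; apply: subalg_gen_M; apply: subalg_gen_in;
  by apply: Or33; exists i => //; apply: odd_white.
- move=> ti; have [j [jb adj _ uniq]] := fixed_odd_node satake red.1 oi ti.
  exists j; split.
    by split=> //; case: (cartan_odd_adjacent oi adj) => ->.
  by move=> j' [jb' /(cartan_odd_neq0 oi) adj']; rewrite (uniq j').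
- move=> j hj; rewrite eq_sym; case: eqVneq => [ti|ti].
    have [jb /(cartan_odd_neq0 oi) adj] := hj ti.
    by rewrite mul1r; apply: Rem_p0_fixed.
  by rewrite !mul0r oppr0 scale0r; apply: Rem_p0_not_fixed.
Qed.
End Main.

Unset Implicit Arguments.

Theorem proposition3p8 (R : realType) (m n : nat) (p : 'I_(m + n) -> bool)
  (hm : #|[set a | ~~ p a]| = m) (hn : #|[set a | p a]| = n)
  (T : 'I_(m + n).-1 ->
       {lrmorphism Uq (qvar R) p -> Uq (qvar R) p})
  (hT : forall i, ~~ npar p i -> braid_operator i (T i))
  (Ib : {set 'I_(m + n).-1}) (tau : 'I_(m + n).-1 -> 'I_(m + n).-1)
  (wb : seq 'I_(m + n).-1) (hwb : longest_expr p Ib wb)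
  (hsatake : super_satake p Ib tau wb)
  (vs kap : 'I_(m + n).-1 -> Cq R)
  (hadm : admissible p Ib tau wb vs kap)
  (i : 'I_(m + n).-1) (hi : npar p i) :
  [/\ Ui T Ib tau wb vs kap (Rem_p0 T tau wb vs kap i),
      tau i = i -> exists! j, j \in Ib /\ cartan p i j <> 0
    & forall j, (tau i = i -> j \in Ib /\ cartan p i j <> 0) ->
      Rem_p0 T tau wb vs kap i =
        - ((i == tau i)%:R * (cartan p i j)%:~R
           * qnode (qvar R) p i ^ cartan p i j * vs i) *: Egen (qvar R) p j].
Proof.
have q0 : qvar R != 0 by rewrite /qvar tofrac_eq0 polyX_eq0.
have q2 : qvar R ^+ 2 != 1.
  rewrite /qvar -tofracXn -tofrac1 tofrac_eq.
  apply/eqP => /(congr1 (size \o polyseq)).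
  by rewrite /= size_polyXn size_poly1.
have two0 : 2 != 0 :> Cq R.
  by rewrite -(tofrac1 _) -tofracMn tofrac_eq0 -polyC_natr polyC_eq0 pnatr_eq0.
exact: (Rem_p0_odd q0 q2 two0 hT hsatake hwb.1 hadm hi).
Qed.
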